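(* Let $\Gamma$ be an $n$-player extensive-form game with perfect recall and let $c^\top\xi$ be a linear objective on correlation plans. An EFCCE $\xi$ that maximizes $c^\top\xi$ can be found by solving the following linear program in the variables $\xi$, $u\in\mathbb R$ and, for each player $i$ and $\hat I\in\mathcal I_i$, $w_{i,\hat I}\in\mathbb R$ and $v_{i,\hat I}\in\mathbb R^{|\mathcal I_i|+1}$: $$\begin{array}{rll}\max & c^\top\xi\\ \text{s.t.} & u-w_{i,\hat I}-v_{i,\hat I}^\top f_i+b_{i,\hat I}^\top\xi\ge0 & \forall i,\ \hat I\in\mathcal I_i\\ & F_i^\top v_{i,\hat I}+w_{i,\hat I}\,e_{\sigma_i(\hat I)}-A_{i,\hat I}^\top\xi\ge0 & \forall i,\ \hat I\in\mathcal I_i\\ & u\le0,\quad\xi\in\Xi,\end{array}$$ where $e_{\sigma_i(\hat I)}\in\mathbb R^{\Sigma_i}$ is the standard basis vector of the sequence $\sigma_i(\hat I)$. In particular, a social-welfare-maximizing EFCCE is obtained by setting the objective to be the social welfare $$c^\top\xi=\sum_{z\in Z}\Big(\sum_{i=1}^n u_i(z)\Big)\,\xi(\sigma_1(z),\dots,\sigma_n(z)).$$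
   Context: **Game.** $\Gamma$ is an $n$-player extensive-form game with perfect recall. Each non-leaf node $v$ belongs to a player $i\in\{1,\dots,n\}$ or to the chance player $\mathsf c$; $A_v$ is its set of actions. $Z$ is the set of leaves, $u_i(z)\in\mathbb R$ Player $i$'s payoff at $z$. The nodes of Player $i$ are partitioned into a collection $\mathcal I_i$ of information sets, with common action set $A_I$ at $I$. $Z_{\hat I}$ is the set of leaves $z$ whose path from the root passes through a node of $\hat I$. **Sequences.** $\Sigma_i=\{(I,a): I\in\mathcal I_i,a\in A_I\}\cup\{\varnothing_i\}$. For a node $v$, $\sigma_i(v)$ is the last $(I,a)\in\Sigma_i$ encountered on the path from the root to $v$, or $\varnothing_i$ if none; $\sigma_i(I)=\sigma_i(v)$ for any $v\in I\in\mathcal I_i$. Information sets $I_i\in\mathcal I_i$, $I_j\in\mathcal I_j$ are connected if there are $u\in I_i$, $v\in I_j$ such that the path from the root to $u$ passes through $v$ or vice versa. For $i\neq j$, sequences $\sigma_i\in\Sigma_i$, $\sigma_j\in\Sigma_j$ are relevant if one of them is empty or their information sets are connected. **Plans.** A reduced-normal-form plan $\pi$ of Player $i$ selects an action $\pi(I)\in A_I$ at exactly those $I\in\mathcal I_i$ reachable given its own other choices. $\Pi_i$ is the set of such plans; $\Pi_i(\varnothing_i)=\Pi_i$, $\Pi_i((I,a))=\Pi_i(\sigma_i(I))\cap\{\pi:\pi(I)=a\}$; $\Pi_i(z)=\Pi_i(\sigma_i(z))$ for $z\in Z$ and $\Pi_i(I)=\Pi_i(\sigma_i(I))$ for $I\in\mathcal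 I_i$. **Sequence-form strategies.** $Q_i\subseteq\mathbb R_{\ge0}^{\Sigma_i}$ is the set of vectors $y$ of the form $y(\sigma)=\sum_{\pi\in\Pi_i(\sigma)}\hat\mu(\pi)$ for a probability distribution $\hat\mu$ over $\Pi_i$. It is known (Koller–Megiddo–von Stengel) that $Q_i=\{y\ge0: F_iy=f_i\}$, where $F_iy=f_i$ denotes the linear system consisting of $y(\varnothing_i)=1$ and $\sum_{a\in A_I}y((I,a))-y(\sigma_i(I))=0$ for all $I\in\mathcal I_i$. **Correlation plans.** A distribution $\mu$ over $\Pi_1\times\dots\times\Pi_n$ induces the vector $\xi$, indexed by tuples $(\sigma_1,\dots,\sigma_n)\in\Sigma_1\times\dots\times\Sigma_n$ of pairwise-relevant sequences, with $\xi(\sigma_1,\dots,\sigma_n)=\sum_{\pi_1\in\Pi_1(\sigma_1),\dots,\pi_n\in\Pi_n(\sigma_n)}\mu(\pi_1,\dots,\pi_n)$. $\Xi$ is the set (a polytope) of all such $\xi$. Write $\xi_i(\sigma;z)=\xi(\sigma_1(z),\dots,\sigma_{i-1}(z),\sigma,\sigma_{i+1}(z),\dots,\sigma_n(z))$. **Matrices.** $A_{i,\hat I}$ and $b_{i,\hat I}$ are the matrix and vector with $\xi^\top A_{i,\hat I}\,y=\sum_{z\in Z_{\hat I}}u_i(z)\xi_i(\sigma_i(\hat I);z)\,y(\sigma_i(z))$ and $b_{i,\hat I}^\top\xi=\sum_{z\in Z_{\hat I}}u_i(z)\xi_i(\sigma_i(z);z)$ for all $\xi$ and $y\in\mathbb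 R^{\Sigma_i}$. **EFCCE (extensive-form coarse-correlated equilibrium).** For $\hat I\in\mathcal I_i$ and a distribution $\hat\mu$ over $\Pi_i(\hat I)$, the $(\hat I,\hat\mu)$-trigger agent for Player $i$ commits to and follows all recommendations (sampled from $\mu$) until reaching a node of $\hat I$ (if ever), and from then on plays a plan sampled from $\hat\mu$ (independently of $\mu$) until the game ends. With all other players following recommendations, its expected utility is expressed as $\hat u_{\hat I}=\sum_{z\in Z_{\hat I}}u_i(z)\,p_z+\sum_{z\in Z\setminus Z_{\hat I}}u_i(z)\,q_z$, where $$p_z=\Big(\sum_{\pi_i\in\Pi_i(\hat I),\ \pi_j\in\Pi_j(z)\,\forall j\ne i}\mu(\pi_1,\dots,\pi_n)\Big)\Big(\sum_{\pi_i\in\Pi_i(z)}\hat\mu(\pi_i)\Big),\qquad q_z=\sum_{\pi_j\in\Pi_j(z)\,\forall j}\mu(\pi_1,\dots,\pi_n).$$ $\mu$ is an EFCCE if for every player $i$, every $\hat I\in\mathcal I_i$ and every $\hat\mu$ over $\Pi_i(\hat I)$, $\hat u_{\hat I}\le u_i$, where $u_i=\sum_{z\in Z}u_i(z)\sum_{\pi_j\in\Pi_j(z)\,\forall j}\mu(\pi_1,\dots,\pi_n)$; social welfare is $\sum_i u_i$. A correlation plan $\xi\in\Xi$ is called an EFCCE if it is induced by some $\mu$ that is an EFCCE. *)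

(* Defs.v *)
From mathcomp Require Import all_boot all_order all_algebra finmap.
From mathcomp Require Import reals.

Set Implicit Arguments.
Unset Strict Implicit.
Unset Printing Implicit Defensive.
Import Order.TTheory GRing.Theory Num.Theory.
Local Open Scope ring_scope.

(* A node of the game tree is the word of the actions that lead to it from the
   root, so that the path from the root to [h] passes through [g] exactly when
   [prefix g h].  [info_at i h = Some I] means that [h] is a node of player [i]
   lying in the information set [I]; the chance nodes are the non-leaf nodes
   [h] with [info_at i h = None] for all [i].  As no chance probability occurs
   in the expected utilities below, the probability that chance plays towards a
   leaf is understood to be a factor of the payoffs at that leaf.  The values
   of [payoff] at words that are not leaves are never used. *)
Record game (R : realType) (n : nat) := Game {
  act : finType;
  nodes : {fset seq act};
  root_node : [::] \in nodes;
  parent_node : forall h a, rcons h a \in nodes -> h \in nodes;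
  info : 'I_n -> finType;
  info_at : forall i, seq act -> option (info i);
  info_at_decision : forall i h,
    info_at i h <> None -> exists a, rcons h a \in nodes;
  info_at_owner : forall i j h,
    info_at i h <> None -> info_at j h <> None -> i = j;
  info_inhabited : forall i (I : info i), exists h, info_at i h = Some I;
  info_actions : forall i (I : info i) h h' a,
    info_at i h = Some I -> info_at i h' = Some I ->
    (rcons h a \in nodes) = (rcons h' a \in nodes);
  payoff : 'I_n -> seq act -> R
}.

Arguments info_at {R n} g i h.
Arguments payoff {R n} g i h.

Section Game.
Context {R : realType} {n : nat} (G : game R n).
Implicit Types (i j : 'I_n) (h z : seq (act G)).

Definition leaf h := ~~ [exists a, rcons h a \in nodes G].

Definition leaves : {fset seq (act G)} := [fset z in nodes G | leaf z]%fset.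

Definition info_nodes i (I : info G i) : seq (seq (act G)) :=
  [seq h <- nodes G | info_at G i h == Some I].

Definition thru i (I : info G i) z : bool :=
  has (fun h => prefix h z) (info_nodes I).

Definition acts i (I : info G i) : {set act G} :=
  [set a | has (fun h => rcons h a \in nodes G) (info_nodes I)].

(* The pairs (I, a) of player [i] met along the word [h] below the node [p]. *)
Fixpoint moves_from i (p h : seq (act G)) : seq (info G i * act G) :=
  if h is a :: h' then
    let rest := moves_from i (rcons p a) h' in
    if info_at G i p is Some K then (K, a) :: rest else rest
  else [::].

Definition moves i h := moves_from i [::] h.

Definition perfect_recall : Prop :=
  forall i (I : info G i) h h',
    info_at G i h = Some I -> info_at G i h' = Some I ->
    moves i h = moves i h'.

(* [None] is the empty sequence. *)
Definition sequence i : finType := option (info G i * act G).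

Definition Sigma i : {set sequence i} :=
  [set s | if s is Some (K, a) then a \in acts K else true].

Definition last_seq i (m : seq (info G i * act G)) : sequence i :=
  last None [seq Some x | x <- m].

Definition seq_at i h : sequence i := last_seq (moves i h).

(* Perfect recall makes the next two notions independent of the node of [I]
   that is used. *)
Definition info_moves i (I : info G i) : seq (info G i * act G) :=
  moves i (head [::] (info_nodes I)).

Definition info_seq i (I : info G i) : sequence i := last_seq (info_moves I).

Definition connected i j (I : info G i) (J : info G j) : bool :=
  has (fun u => has (fun v => prefix u v || prefix v u) (info_nodes J))
      (info_nodes I).

Definition relevant i j (s : sequence i) (t : sequence j) : bool :=
  match s, t with
  | Some (K, _), Some (L, _) => connected K L
  | _, _ => true
  end.

Definition profile : finType := {dffun forall i, sequence i}.

Definition is_relevant_profile (s : profile) : bool :=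
  [forall i, s i \in Sigma i] &&
  [forall i, forall j, (i != j) ==> relevant (s i) (s j)].

Definition rprofile : finType := {s : profile | is_relevant_profile s}.

Definition agrees i (f : {ffun info G i -> option (act G)})
    (m : seq (info G i * act G)) : bool :=
  all (fun x => f x.1 == Some x.2) m.

Definition reachable i (f : {ffun info G i -> option (act G)}) (I : info G i) : bool :=
  has (fun h => agrees f (moves i h)) (info_nodes I).

Definition is_plan i (f : {ffun info G i -> option (act G)}) : bool :=
  [forall I, if f I is Some a then reachable f I && (a \in acts I)
             else ~~ reachable f I].

Definition plan i : finType :=
  {f : {ffun info G i -> option (act G)} | is_plan f}.

(* The successive sequences that lead to, and include, the sequence [s]. *)
Definition seq_moves i (s : sequence i) : seq (info G i * act G) :=
  if s is Some (K, a) then rcons (info_moves K) (K, a) else [::].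

(* The recursion on sequences that defines these sets, unfolded; see
   [plans_at_None] and [plans_at_Some]. *)
Definition plans_at i (s : sequence i) : {set plan i} :=
  [set p : plan i | agrees (val p) (seq_moves s)].

Definition plan_profile : finType := {dffun forall i, plan i}.

Definition distribution (T : finType) (mu : {ffun T -> R}) : Prop :=
  (forall x, 0 <= mu x) /\ \sum_x mu x = 1.

Definition mass (mu : {ffun plan_profile -> R}) (s : profile) : R :=
  \sum_(p : plan_profile | [forall j, p j \in plans_at (s j)]) mu p.

Definition cplan := {ffun rprofile -> R}.

Definition induced (mu : {ffun plan_profile -> R}) : cplan :=
  [ffun s => mass mu (val s)].

Definition Xi (xi : cplan) : Prop :=
  exists mu, distribution mu /\ xi = induced mu.

Definition dot (c xi : cplan) : R := \sum_s c s * xi s.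

(* The entry of [xi] at [s]; the value 0 at profiles that are not relevant is
   never used, by [seqs_at_relevant], [dev_self] and [dev_relevant]. *)
Definition entry (xi : cplan) (s : profile) : R :=
  if insub s is Some t then xi t else 0.

Definition seqs_at z : profile := finfun (fun j => seq_at j z).

Definition dev i (s : sequence i) z : profile :=
  finfun (dfwith (fun j => seq_at j z) s).

Definition utility (mu : {ffun plan_profile -> R}) i : R :=
  \sum_(z <- leaves) payoff G i z * mass mu (seqs_at z).

Definition welfare (mu : {ffun plan_profile -> R}) : R :=
  \sum_i utility mu i.

Definition trigger_utility (mu : {ffun plan_profile -> R})
    i (I : info G i) (nu : {ffun plan i -> R}) : R :=
  \sum_(z <- leaves | thru I z)
     payoff G i z * (mass mu (dev (info_seq I) z) *
                     \sum_(p in plans_at (seq_at i z)) nu p) +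
  \sum_(z <- leaves | ~~ thru I z) payoff G i z * mass mu (seqs_at z).

Definition efcce (mu : {ffun plan_profile -> R}) : Prop :=
  distribution mu /\
  forall i (I : info G i) (nu : {ffun plan i -> R}),
    distribution nu ->
    (forall p, p \notin plans_at (info_seq I) -> nu p = 0) ->
    trigger_utility mu I nu <= utility mu i.

Definition efcce_cplan (xi : cplan) : Prop :=
  exists mu, efcce mu /\ xi = induced mu.

Definition max_efcce (c xi : cplan) : Prop :=
  efcce_cplan xi /\ forall xi', efcce_cplan xi' -> dot c xi' <= dot c xi.

Definition welfare_max_efcce (xi : cplan) : Prop :=
  exists mu, [/\ efcce mu, xi = induced mu &
                 forall mu', efcce mu' -> welfare mu' <= welfare mu].

(* Row [None] of the system F_i y = f_i is y(empty) = 1; row [Some K] is the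
   flow equation of [K]. *)
Definition F_mx i (r : option (info G i)) (s : sequence i) : R :=
  match r with
  | None => (s == None)%:R
  | Some K => (\sum_(a in acts K) (s == Some (K, a))%:R) - (s == info_seq K)%:R
  end.

Definition f_vec i (r : option (info G i)) : R := (r == None)%:R.

(* See [A_mxE] and [b_vecE]. *)
Definition A_mx i (I : info G i) (s : rprofile) (t : sequence i) : R :=
  \sum_(z <- leaves | thru I z)
     payoff G i z * (val s == dev (info_seq I) z)%:R * (t == seq_at i z)%:R.

Definition b_vec i (I : info G i) (s : rprofile) : R :=
  \sum_(z <- leaves | thru I z)
     payoff G i z * (val s == dev (seq_at i z) z)%:R.

Definition welfare_obj : cplan :=
  [ffun s => \sum_(z <- leaves)
               (\sum_i payoff G i z) * (val s == seqs_at z)%:R].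

Definition lp_w := forall i, info G i -> R.
Definition lp_v := forall i, info G i -> {ffun option (info G i) -> R}.

Definition lp_feasible (xi : cplan) (u : R) (w : lp_w) (v : lp_v) : Prop :=
  [/\ forall i (I : info G i),
        0 <= u - w i I - (\sum_r v i I r * f_vec r) + \sum_s b_vec I s * xi s,
      forall i (I : info G i) (t : sequence i), t \in Sigma i ->
        0 <= (\sum_r F_mx r t * v i I r) + w i I * (t == info_seq I)%:R
             - \sum_s A_mx I s t * xi s,
      u <= 0 &
      Xi xi].

Definition lp_optimal (c xi : cplan) (u : R) (w : lp_w) (v : lp_v) : Prop :=
  lp_feasible xi u w v /\
  forall xi' u' w' v', lp_feasible xi' u' w' v' -> dot c xi' <= dot c xi.

End Game.

Arguments efcce {R n G} mu.
Arguments mass {R n G} mu s.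

Section Sanity.
Context {R : realType} {n : nat} (G : game R n).
Implicit Types (i j : 'I_n) (h z : seq (act G)).

Lemma sum_entry (xi : cplan G) (s : profile G) :
  \sum_t xi t * (val t == s)%:R = entry xi s.
Proof.
rewrite /entry; case: insubP => [t _ <-|ns].
  rewrite (bigD1 t) //= eqxx mulr1 big1 ?addr0 // => t' nt.
  by rewrite (inj_eq val_inj) (negbTE nt) mulr0.
apply: big1 => t _; case: eqP => [e|_]; last by rewrite mulr0.
by move: (valP t) ns; rewrite /= e => ->.
Qed.

Lemma welfare_objE (xi : cplan G) :
  dot (welfare_obj G) xi =
  \sum_(z <- leaves G) (\sum_i payoff G i z) * entry xi (seqs_at z).
Proof.
rewrite /dot.
under eq_bigr => s _ do rewrite ffunE big_distrl /=.
rewrite exchange_big /=; apply: eq_bigr => z _.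
rewrite -sum_entry big_distrr /=; apply: eq_bigr => s _.
by rewrite -mulrA [_%:R * _]mulrC.
Qed.

Lemma b_vecE i (I : info G i) (xi : cplan G) :
  \sum_s b_vec I s * xi s =
  \sum_(z <- leaves G | thru I z) payoff G i z * entry xi (dev (seq_at i z) z).
Proof.
under eq_bigr => s _ do rewrite big_distrl /=.
rewrite exchange_big /=; apply: eq_bigr => z _.
rewrite -sum_entry big_distrr /=; apply: eq_bigr => s _.
by rewrite -mulrA [_%:R * _]mulrC.
Qed.

Lemma moves_from_cat i (p h h' : seq (act G)) :
  moves_from i p (h ++ h') = moves_from i p h ++ moves_from i (p ++ h) h'.
Proof.
elim: h p => [|a h IH] p /=; first by rewrite cats0.
by rewrite IH -cats1 -catA /=; case: (info_at G i p).
Qed.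


Lemma last_seq_rcons i (m : seq (info G i * act G)) x :
  last_seq (rcons m x) = Some x.
Proof. by rewrite /last_seq map_rcons last_rcons. Qed.

Lemma prefix_node g h : prefix g h -> h \in nodes G -> g \in nodes G.
Proof.
case/prefixP => s ->; elim/last_ind: s => [|s a IH]; first by rewrite cats0.
by rewrite -rcons_cat => /parent_node.
Qed.

Lemma info_node i h I : info_at G i h = Some I -> h \in info_nodes I.
Proof.
move=> e; rewrite mem_filter e eqxx /=.
have [|a] := @info_at_decision _ _ G i h; first by rewrite e.
exact: parent_node.
Qed.

Lemma moves_rcons_inv i h m I a :
  moves i h = rcons m (I, a) ->
  exists g, [/\ prefix (rcons g a) h, info_at G i g = Some I & moves i g = m].
Proof.
elim/last_ind: h m => [|h b IH] m; first by case: m.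
rewrite /moves -cats1 moves_from_cat /=.
case e: (info_at G i h) => [J|]; last first.
  rewrite cats0 => /IH [g [pg eg mg]]; exists g; split=> //.
  exact: prefix_trans pg (prefix_prefix _ _).
rewrite cats1 => /rcons_inj [<- <- <-]; exists h; split=> //.
by rewrite cats1 prefix_refl.
Qed.

Lemma moves_last i h I a :
  seq_at i h = Some (I, a) ->
  exists g, [/\ prefix (rcons g a) h, info_at G i g = Some I &
                moves i h = rcons (moves i g) (I, a)].
Proof.
rewrite /seq_at; case/lastP e: (moves i h) => [//|m [J b]].
rewrite last_seq_rcons => -[<- <-].
by have [g [pg eg <-]] := moves_rcons_inv e; exists g.
Qed.

Lemma seq_at_Sigma i h : h \in nodes G -> seq_at i h \in Sigma G i.
Proof.
move=> hN; rewrite inE; case e: (seq_at i h) => [[I a]|//].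
have [g [pg eg _]] := moves_last e.
rewrite inE; apply/hasP; exists g; first exact: info_node.
exact: prefix_node pg hN.
Qed.

Lemma info_head i (I : info G i) :
  head [::] (info_nodes I) \in info_nodes I.
Proof.
have [h /info_node] := info_inhabited I.
by case: (info_nodes I) => //= x s _; rewrite mem_head.
Qed.

Lemma info_movesE i (I : info G i) h :
  perfect_recall G -> info_at G i h = Some I -> info_moves I = moves i h.
Proof.
move=> pr e; apply: (pr _ I) => //.
by have := info_head I; rewrite mem_filter => /andP[/eqP].
Qed.

Lemma plans_at_None i : plans_at (None : sequence G i) = setT.
Proof. by apply/setP => p; rewrite !inE. Qed.

Lemma plans_at_Some i (I : info G i) a : perfect_recall G ->
  plans_at (Some (I, a) : sequence G i) =
  plans_at (info_seq I) :&: [set p : plan G i | val p I == Some a].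
Proof.
move=> pr; apply/setP => p; rewrite !inE /agrees /= all_rcons andbC /=.
congr (_ && _); rewrite /info_seq; case/lastP e: (info_moves I) => [//|m [J b]].
rewrite last_seq_rcons /=.
have [g [_ eg <-]] := moves_rcons_inv e.
by rewrite (info_movesE pr eg).
Qed.

Lemma prefix_total (u v h : seq (act G)) :
  prefix u h -> prefix v h -> prefix u v || prefix v u.
Proof.
rewrite !prefixE => /eqP eu /eqP ev.
case: (leqP (size u) (size v)) => [le|/ltnW le].
  by rewrite -ev take_takel // eu eqxx.
by rewrite -[X in _ || (take _ X == _)]eu take_takel // ev eqxx orbT.
Qed.

Lemma seq_prefix_relevant i j u v z :
  prefix u z -> prefix v z -> u \in nodes G -> v \in nodes G ->
  relevant (seq_at i u) (seq_at j v).
Proof.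
move=> pu pv uN vN; rewrite /relevant.
case eu: (seq_at i u) => [[I a]|//]; case ev: (seq_at j v) => [[J b]|//].
have [g [pg eg _]] := moves_last eu; have [k [pk ek _]] := moves_last ev.
apply/hasP; exists g; first exact: info_node.
apply/hasP; exists k; first exact: info_node.
apply: (@prefix_total _ _ z).
  by apply: prefix_trans pu; apply: prefix_trans pg; apply: prefix_rcons.
by apply: prefix_trans pv; apply: prefix_trans pk; apply: prefix_rcons.
Qed.

Lemma leaf_node z : z \in leaves G -> z \in nodes G.
Proof. by rewrite !inE => /andP[]. Qed.

Lemma seqs_at_relevant z : z \in leaves G -> is_relevant_profile (seqs_at z).
Proof.
move=> /leaf_node zN; apply/andP; split; apply/forallP => i.
  by rewrite ffunE seq_at_Sigma.
apply/forallP => j; apply/implyP => _; rewrite !ffunE.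
by apply: (@seq_prefix_relevant _ _ _ _ z) => //; apply: prefix_refl.
Qed.

Lemma dev_relevant i (I : info G i) z :
  perfect_recall G -> z \in leaves G -> thru I z ->
  is_relevant_profile (dev (info_seq I) z).
Proof.
move=> pr /leaf_node zN /hasP[u]; rewrite mem_filter => /andP[/eqP uI uN] uz.
have es : info_seq I = seq_at i u by rewrite /info_seq (info_movesE pr uI).
pose w j := if j == i then u else z.
have wP j : prefix (w j) z && (w j \in nodes G).
  by rewrite /w; case: ifP => _; rewrite ?uz ?uN ?prefix_refl ?zN.
have dE j : dev (info_seq I) z j = seq_at j (w j).
  rewrite ffunE /w; case: (eqVneq j i) => [->|ne]; first by rewrite dfwith_in.
  by rewrite dfwith_out // eq_sym.
apply/andP; split; apply/forallP => j.
  by rewrite dE seq_at_Sigma //; case/andP: (wP j).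
apply/forallP => k; apply/implyP => _; rewrite !dE.
case/andP: (wP j) => ? ?; case/andP: (wP k) => ? ?.
exact: (@seq_prefix_relevant _ _ _ _ z).
Qed.

Lemma dev_self i z : dev (seq_at i z) z = seqs_at z.
Proof.
apply/ffunP => j; rewrite !ffunE.
by case: (eqVneq i j) => [<-|ne]; rewrite ?dfwith_in ?dfwith_out.
Qed.

Lemma A_mxE i (I : info G i) (xi : cplan G) (y : sequence G i -> R) :
  \sum_s \sum_(t in Sigma G i) xi s * A_mx I s t * y t =
  \sum_(z <- leaves G | thru I z)
     payoff G i z * entry xi (dev (info_seq I) z) * y (seq_at i z).
Proof.
under eq_bigr => s _ do under eq_bigr => t _ do
  rewrite /A_mx big_distrr big_distrl /=.
under eq_bigr => s _ do rewrite exchange_big /=.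
rewrite exchange_big /= big_seq_cond [RHS]big_seq_cond.
apply: eq_bigr => z /andP[zL _].
rewrite -sum_entry big_distrr big_distrl /=; apply: eq_bigr => s _.
rewrite (bigD1 (seq_at i z)) ?seq_at_Sigma ?leaf_node //= eqxx mulr1.
rewrite big1 ?addr0 => [|t /andP[_ nt]].
  by congr (_ * _); rewrite mulrCA.
by rewrite (negbTE nt) !mulr0 mul0r.
Qed.

End Sanity.

(* Main.v *)
(** Fix a trigger information set [I] and a correlation plan [xi] in [Xi]. The
    LP constraints for [I] (with [u = 0]) are dual feasibility for the linear
    program that maximises the deviator's payoff over sequence-form strategies
    through [I]. Weak duality, applied to the realisation vector of each single
    plan, shows that feasible [xi] are EFCCEs. Conversely, backward induction
    below [I] gives an explicit dual solution whose value is attained by a greedy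
    plan, so no abstract strong duality theorem is needed.

    It remains to see that an optimum exists. The EFCCE conditions are finitely
    many linear inequalities on a simplex, so by compactness it is enough that
    one EFCCE exists, and this follows by the argument of Hart and Schmeidler. *)
Require Import Defs.
From mathcomp Require Import all_boot all_order all_algebra finmap.
From mathcomp Require Import reals.
From mathcomp Require Import ring lra.
From mathcomp Require Import boolp classical_sets functions topology normedtype.
From mathcomp Require Import derive set_interval.

Set Implicit Arguments.
Unset Strict Implicit.
Unset Printing Implicit Defensive.
Import Order.TTheory GRing.Theory Num.Theory.
Local Open Scope ring_scope.

(** * Splitting lists at an element *)

Lemma mem_split (A : eqType) (x : A) (m : seq A) :
  x \in m -> exists m1 m2, m = m1 ++ x :: m2.
Proof. by case/splitPr => m1 m2; exists m1, m2. Qed.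

Lemma unzip1_split (A B : eqType) (x : A) (m : seq (A * B)) :
  x \in unzip1 m -> exists m1 b m2, m = m1 ++ (x, b) :: m2.
Proof.
case/mapP=> -[x' b] /mem_split[m1 [m2 ->]] /= ->.
by exists m1, b, m2.
Qed.

(** * Sums over option types and dependent profiles *)

Section BigSums.
Context {R : realType}.

Lemma sum_option (T : finType) (F : option T -> R) :
  \sum_r F r = F None + \sum_t F (Some t).
Proof.
rewrite (bigD1 None) //=; congr (_ + _).
rewrite (reindex_omap Some id) => [|[]] //=.
by apply: eq_bigl => t; rewrite eqxx.
Qed.

(** Distributivity with factors of varying type: each sum is moved to the tagged union of the
    [T_ k], where the uniform law applies, and the outcome is read back through [fprod]. *)
Lemma sum_dffun_prod (I : finType) (T_ : I -> finType)
    (F : forall k, {ffun T_ k -> R}) :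
  \sum_(p : {dffun forall k, T_ k}) \prod_k F k (p k) = \prod_k \sum_t F k t.
Proof.
under [RHS]eq_bigr => k _ do rewrite (big_tag (fun k t => F k t) k).
rewrite bigA_distr_big_dep.
rewrite (reindex (@dffun_of_fprod _ T_)); last exact/onW_bij/dffun_of_fprod_bij.
transitivity (\sum_(t : fprod T_) \prod_k F k (t k)).
  by apply: eq_bigr => t _; apply: eq_bigr => k _; rewrite ffunE.
by rewrite (big_fprod_dep _ _ F predT); apply: eq_bigl => g; rewrite andbT.
Qed.

End BigSums.

(** * Distributions on a finite set and their expectations *)

Section Simplex.
Context {R : realType}.
Implicit Types (T K : finType).

Definition expect T (x : {ffun T -> R}) (f : T -> R) : R := \sum_t x t * f t.

Definition point T (t : T) : {ffun T -> R} := [ffun t' => (t' == t)%:R].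

Lemma expect_point T (t : T) f : expect (point t) f = f t.
Proof.
rewrite /expect (bigD1 t) //= ffunE eqxx mul1r big1 ?addr0 // => t' /negbTE nt.
by rewrite ffunE nt mul0r.
Qed.

Lemma distribution_point T (t : T) : distribution (point t).
Proof.
split=> [t'|]; first by rewrite ffunE ler0n.
rewrite -[RHS](expect_point t (fun=> 1)).
by apply: eq_bigr => t' _; rewrite mulr1.
Qed.

Lemma expect_cst T (x : {ffun T -> R}) c : distribution x ->
  expect x (fun=> c) = c.
Proof. by case=> _ x1; rewrite /expect -big_distrl /= x1 mul1r. Qed.

Lemma expect_le T (x : {ffun T -> R}) f g : distribution x ->
  (forall t, x t != 0 -> f t <= g t) -> expect x f <= expect x g.
Proof.
case=> x0 _ le; apply: ler_sum => t _.
have [->|nz] := eqVneq (x t) 0; first by rewrite !mul0r.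
by rewrite ler_wpM2l ?le.
Qed.

Lemma distribution_mix T (x y : {ffun T -> R}) (e : R) :
  0 <= e <= 1 -> distribution x -> distribution y ->
  distribution [ffun t => (1 - e) * x t + e * y t].
Proof.
case/andP=> e0 e1 [x0 x1] [y0 y1]; split=> [t|].
  by rewrite ffunE addr_ge0 ?mulr_ge0 ?subr_ge0.
under eq_bigr do rewrite ffunE.
by rewrite big_split /= -!big_distrr /= x1 y1 !mulr1 subrK.
Qed.

Lemma expect_mix T (x y : {ffun T -> R}) (e : R) f :
  expect [ffun t => (1 - e) * x t + e * y t] f =
  (1 - e) * expect x f + e * expect y f.
Proof.
rewrite /expect !big_distrr -big_split /=; apply: eq_bigr => t _.
by rewrite ffunE mulrDl !mulrA.
Qed.

Lemma expect_sum T (Z : Type) (x : {ffun T -> R}) (r : seq Z) (P : pred Z)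
    (c : Z -> R) (f : Z -> T -> R) :
  expect x (fun t => \sum_(z <- r | P z) c z * f z t) =
  \sum_(z <- r | P z) c z * expect x (f z).
Proof.
rewrite /expect; under eq_bigr do rewrite big_distrr /=.
rewrite exchange_big; apply: eq_bigr => z _ /=; rewrite big_distrr /=.
by apply: eq_bigr => t _; rewrite mulrCA.
Qed.

Lemma expectB T (x : {ffun T -> R}) f g :
  expect x (fun t => f t - g t) = expect x f - expect x g.
Proof. by rewrite /expect -sumrB; apply: eq_bigr => t _; rewrite mulrBr. Qed.

Lemma expect0 T (x : {ffun T -> R}) : expect x (fun=> 0) = 0.
Proof. by rewrite /expect big1 // => t _; rewrite mulr0. Qed.

Lemma eq_expect T (x : {ffun T -> R}) f g :
  f =1 g -> expect x f = expect x g.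
Proof. by move=> fg; apply: eq_bigr => t _; rewrite fg. Qed.

(** * Compactness and linear feasibility on the simplex *)

Import numFieldNormedType.Exports.
Local Open Scope classical_set_scope.

(** Compactness and continuity are argued on row vectors, then carried over to finite functions. *)
Definition of_row T (v : 'rV[R]_#|T|) : {ffun T -> R} :=
  [ffun t => v ord0 (enum_rank t)].

Lemma of_rowK T (x : {ffun T -> R}) :
  of_row (\row_i x (enum_val i)) = x.
Proof. by apply/ffunP => t; rewrite ffunE mxE enum_rankK. Qed.

Lemma continuous_sum (V : topologicalType) K (f : K -> V -> R) :
  (forall k, continuous (f k)) -> continuous (fun v => \sum_k f k v).
Proof.
move=> cf; elim: (index_enum K) => [|k s IH] v.
  by under eq_fun do rewrite big_nil; exact: cvg_cst.
under eq_fun do rewrite big_cons.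
by apply: cvgD; [exact: cf|exact: IH].
Qed.

Lemma continuous_expect T (f : T -> R) :
  continuous (fun v => expect (of_row v) f).
Proof.
apply: continuous_sum => t v; rewrite /of_row.
under eq_fun do rewrite ffunE.
apply: (@continuousM R _ (fun x : 'rV[R]_#|T| => x ord0 (enum_rank t)) (cst (f t)) v).
  exact: coord_continuous.
exact: cst_continuous.
Qed.

(** The feasible set is a closed part of the unit cube, hence compact, and the extreme value theorem
    applies. *)
Lemma polytope_min T K (l : K -> T -> R) (F : {ffun T -> R} -> R) :
  continuous (fun v => F (of_row v)) ->
  (exists x, distribution x /\ forall k, expect x (l k) <= 0) ->
  exists x, [/\ distribution x, forall k, expect x (l k) <= 0 &
    forall y, distribution y -> (forall k, expect y (l k) <= 0) -> F x <= F y].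
Proof.
move=> cF [x0 [dx0 lx0]].
pose A := [set v | distribution (of_row v) /\
                   forall k, expect (of_row v) (l k) <= 0] : set 'rV[R]_#|T|.
have cA : compact A.
  have -> : A = [set v : 'rV[R]_#|T| | forall i, `[0%R, 1%R]%classic (v ord0 i)] `&`
      ([set v | expect (of_row v) (fun=> 1) = 1] `&`
       \bigcap_(k in [set: K]) [set v | expect (of_row v) (l k) <= 0]).
    apply/seteqP; split=> v; rewrite /A /=.
      move=> [[v0 v1] lv]; split; last first.
        by split=> // [|k _]; [rewrite expect_cst | exact: lv].
      move=> i; rewrite in_itv /=; have := v0 (enum_val i).
      rewrite ffunE enum_valK => -> /=; rewrite -v1 (bigD1 (enum_val i)) //=.
      by rewrite ffunE enum_valK lerDl sumr_ge0.
    move=> [vI [v1 lv]]; split=> [|k]; last exact: (lv k).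
    split=> [t|].
      by rewrite ffunE; have := vI (enum_rank t); rewrite in_itv => /andP[].
    by rewrite -[RHS]v1; apply: eq_bigr => t _; rewrite mulr1.
  apply: compact_closedI.
    apply: (@rV_compact R _ (fun=> `[0%R, 1%R]%classic)) => i.
    exact: segment_compact.
  apply: closedI.
    apply: (@closed_comp _ _ (fun v => expect (of_row v) (fun=> 1)) [set x | x = 1]).
      by move=> v _; exact: continuous_expect.
    exact: closed_eq.
  apply: closed_bigI => k _.
  apply: (@closed_comp _ _ (fun v => expect (of_row v) (l k)) [set x | x <= 0]).
    by move=> v _; exact: continuous_expect.
  exact: closed_le.
have [||v vA vmin] := @EVT_min_rV R _ (fun v => F (of_row v)) A _ cA.
- by exists (\row_i x0 (enum_val i)); rewrite /A /= of_rowK.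
- exact: continuous_subspaceT.
exists (of_row v); move: vA; rewrite inE => -[dv lv]; split=> // y dy ly.
have := vmin (\row_i y (enum_val i)); rewrite of_rowK; apply.
by rewrite inE /A /= of_rowK.
Qed.


(* If every nonnegative combination of the constraints can be satisfied, so can
   all of them at once: at a minimiser [x] of the sum of the squares of the
   violations, moving towards a solution of the combination weighted by these
   violations would otherwise decrease that sum. *)
Lemma simplex_feasible T K (l : K -> T -> R) :
  (forall lam : K -> R, (forall k, 0 <= lam k) ->
     exists x, distribution x /\ \sum_k lam k * expect x (l k) <= 0) ->
  exists x, distribution x /\ forall k, expect x (l k) <= 0.
Proof.
move=> H; pose p (a : R) := Num.max a 0.
pose F (x : {ffun T -> R}) := \sum_k p (expect x (l k)) ^+ 2.
have cF : continuous (fun v => F (of_row v)).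
  apply: continuous_sum => k v.
  have cp : {for v, continuous (fun v => p (expect (of_row v) (l k)))}.
    apply: continuous_max; first exact: continuous_expect.
    exact: cst_continuous.
  exact: (continuousM cp cp).
have [x0 [dx0 _]] := H (fun=> 0) (fun=> lexx 0).
(* With the empty index type this minimises over the whole simplex. *)
have [|x [dx _ xmin]] := @polytope_min T void (fun k => match k with end) F cF.
  by exists x0; split=> // -[].
have p0 a : 0 <= p a by rewrite le_max lexx orbT.
have [y [dy Sy]] := H (fun k => p (expect x (l k))) (fun k => p0 _).
pose C := \sum_k expect y (l k) ^+ 2.
pose S := \sum_k p (expect x (l k)) * expect y (l k).
have C0 : 0 <= C by apply: sumr_ge0 => k _; rewrite sqr_ge0.
have F0 : 0 <= F x by apply: sumr_ge0 => k _; rewrite sqr_ge0.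
(* If the mixture is positive, replacing [a] by [p a] can only increase it; otherwise the left side
   is 0. *)
have pmix (a b e : R) : 0 <= e <= 1 ->
    p ((1 - e) * a + e * b) ^+ 2 <= ((1 - e) * p a + e * b) ^+ 2.
  case/andP=> e0 e1; rewrite /p.
  have [//|h1] := leP ((1 - e) * a + e * b) 0; first by rewrite expr0n sqr_ge0.
  rewrite ler_sqr ?nnegrE ?(ltW h1) //; first by have [|] := leP a 0; nra.
  by have [|] := leP a 0; nra.
have Fe e : 0 <= e <= 1 ->
    F x <= (1 - e) ^+ 2 * F x + 2 * e * (1 - e) * S + e ^+ 2 * C.
  move=> e01; apply: le_trans (xmin _ (distribution_mix e01 dx dy) _) _; first by case.
  rewrite /F /S /C !big_distrr -!big_split /=; apply: ler_sum => k _.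
  rewrite expect_mix; apply: le_trans (pmix _ _ _ e01) _.
  by rewrite le_eqVlt; apply/orP; left; apply/eqP; ring.
have Fx : F x = 0.
  apply/eqP; rewrite eq_le F0 andbT leNgt; apply/negP => Fp.
  have FC : 0 < F x + C by rewrite ltr_wpDr.
  (* As [S <= 0], the bound [Fe] gives [F x <= (1 - e)^2 * F x + e^2 * C]; this [e] minimises the
     right side and makes it smaller than [F x]. *)
  pose e := F x / (F x + C).
  have e0 : 0 < e by rewrite divr_gt0.
  have e1 : e <= 1 by rewrite ler_pdivrMr // mul1r lerDl.
  have eFC : e * (F x + C) = F x by rewrite divfK ?gt_eqF.
  have := Fe e; rewrite (ltW e0) e1 => /(_ isT).
  have : e * (1 - e) * S <= 0 by rewrite mulr_ge0_le0 // mulr_ge0 ?subr_ge0 // ltW.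
  have : 0 < e * F x by rewrite mulr_gt0.
  have : e ^+ 2 * C = e * F x - e ^+ 2 * F x by rewrite -{1}eFC; ring.
  nra.
exists x; split=> // k; move/eqP: Fx.
rewrite psumr_eq0; last by move=> *; rewrite sqr_ge0.
move/allP/(_ k); rewrite mem_index_enum sqrf_eq0 => /(_ isT) /eqP pk.
by rewrite -pk le_max lexx.
Qed.

(** Stationarity says that the weighted net inflow [l q] vanishes at every [q]. Asking only for
    nonpositive inflows makes [simplex_feasible] applicable: against weights [theta], a point mass
    at a maximiser of [theta] works, since no [phi k] can raise [theta] there. *)
Lemma stationary_distribution T K (phi : K -> T -> T) (lam : K -> R) (t0 : T) :
  (forall k, 0 <= lam k) ->
  exists x, distribution x /\
    forall g, \sum_k lam k * (expect x (g \o phi k) - expect x g) = 0.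
Proof.
move=> lam0.
pose l (q p : T) := \sum_k lam k * ((phi k p == q)%:R - (p == q)%:R).
have sum1 (g : T -> R) p : \sum_q g q * (p == q)%:R = g p.
  rewrite (bigD1 p) //= eqxx mulr1 big1 ?addr0 // => q; rewrite eq_sym => /negbTE ->.
  by rewrite mulr0.
have sum_l g p : \sum_q g q * l q p = \sum_k lam k * (g (phi k p) - g p).
  under eq_bigr => q _ do rewrite big_distrr /=.
  rewrite exchange_big; apply: eq_bigr => k _ /=.
  under eq_bigr => q _ do rewrite mulrCA mulrBr.
  by rewrite -big_distrr /= sumrB !sum1.
have sum_exp g x : \sum_q g q * expect x (l q) =
    \sum_k lam k * (expect x (g \o phi k) - expect x g).
  under eq_bigr => q _ do rewrite big_distrr /=.
  rewrite exchange_big /=.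
  under eq_bigr => t _ do under eq_bigr => q _ do rewrite mulrCA.
  under eq_bigr => t _ do rewrite -big_distrr /= sum_l big_distrr /=.
  rewrite exchange_big; apply: eq_bigr => k _ /=.
  rewrite /expect -sumrB big_distrr; apply: eq_bigr => t _ /=.
  by rewrite mulrCA mulrBr.
have [theta theta0|x [dx lx]] := @simplex_feasible T T l.
  case: (@Order.TotalTheory.arg_maxP _ R T t0 predT theta) => // p _ pmax.
  exists (point p); split; first exact: distribution_point.
  rewrite sum_exp; apply: sumr_le0 => k _.
  by rewrite !expect_point mulr_ge0_le0 // subr_le0; exact: pmax.
exists x; split=> // g; rewrite -sum_exp big1 // => q _.
suff -> : expect x (l q) = 0 by rewrite mulr0.
(* The net inflows sum to 0, so being nonpositive they all vanish. *)
have : \sum_q - expect x (l q) = 0.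
  rewrite sumrN; have := sum_exp (fun=> 1) x.
  under eq_bigr => t _ do rewrite mul1r.
  by move=> ->; rewrite big1 ?oppr0 // => k _; rewrite subrr mulr0.
move/eqP; rewrite psumr_eq0 => [/allP/(_ q)|t _]; last by rewrite oppr_ge0.
by rewrite mem_index_enum oppr_eq0 => /(_ isT)/eqP.
Qed.

End Simplex.

(** * Move lists under perfect recall *)

Section Plans.
Context {R : realType} {n : nat} (G : game R n) (recall : perfect_recall G).
Implicit Types (i j : 'I_n) (h z : seq (act G)).

Lemma moves_prefix i h m1 m2 : moves i h = m1 ++ m2 ->
  exists2 g, prefix g h & moves i g = m1.
Proof.
elim/last_ind: m2 h => [|m2 [K a] IH] h.
  by rewrite cats0 => <-; exists h; rewrite ?prefix_refl.
rewrite -rcons_cat => /moves_rcons_inv[g [pg _ /IH[g' pg' mg']]].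
by exists g' => //; apply: prefix_trans pg' (prefix_trans (prefix_rcons _ _) pg).
Qed.

Lemma moves_split i h m1 (K : info G i) a m2 : moves i h = m1 ++ (K, a) :: m2 ->
  info_moves K = m1 /\
  exists g, [/\ prefix (rcons g a) h, info_at G i g = Some K & moves i g = m1].
Proof.
rewrite -cat_rcons => /moves_prefix[g' pg' /moves_rcons_inv[g [pg eg mg]]].
split; first by rewrite (info_movesE recall eg).
by exists g; split=> //; apply: prefix_trans pg pg'.
Qed.

(** Perfect recall in list form: the moves before an entry at [K] are the ones that [K] itself
    remembers. *)
Definition coherent i (m : seq (info G i * act G)) : Prop :=
  forall m1 K a m2, m = m1 ++ (K, a) :: m2 -> info_moves K = m1.

Lemma coherent_moves i h : coherent (moves i h).
Proof. by move=> m1 K a m2 /moves_split[]. Qed.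

Lemma coherent_info_moves i (I : info G i) : coherent (info_moves I).
Proof. exact: coherent_moves. Qed.

Lemma coherent_rcons i m (K : info G i) a :
  coherent (rcons m (K, a)) -> info_moves K = m /\ coherent m.
Proof.
move=> cm; split; first by apply: (cm _ K a [::]); rewrite cats1.
by move=> m1 J b m2 em; apply: (cm _ _ b (rcons m2 (K, a))); rewrite em rcons_cat.
Qed.

Lemma seq_moves_seq_at i h : seq_moves (seq_at i h) = moves i h.
Proof.
case e: (seq_at i h) => [[K a]|] /=.
  by have [g [_ eg ->]] := moves_last e; rewrite (info_movesE recall eg).
move: e; rewrite /seq_at; case/lastP: (moves i h) => // m x.
by rewrite last_seq_rcons.
Qed.

Lemma info_seq_at i (I : info G i) :
  info_seq I = seq_at i (head [::] (info_nodes I)).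
Proof. by []. Qed.

Lemma seq_moves_info_seq i (I : info G i) : seq_moves (info_seq I) = info_moves I.
Proof. exact: seq_moves_seq_at. Qed.

Lemma info_seq_Sigma i (I : info G i) : info_seq I \in Sigma G i.
Proof.
rewrite info_seq_at seq_at_Sigma //.
by have := info_head I; rewrite mem_filter => /andP[].
Qed.

Lemma plans_at_seq_at i (p : plan G i) z :
  (p \in plans_at (seq_at i z)) = agrees (val p) (moves i z).
Proof. by rewrite inE seq_moves_seq_at. Qed.

Lemma plans_at_info_seq i (p : plan G i) I :
  (p \in plans_at (info_seq I)) = agrees (val p) (info_moves I).
Proof. exact: plans_at_seq_at. Qed.

Lemma reachableE i (f : {ffun info G i -> option (act G)}) I :
  reachable f I = agrees f (info_moves I).
Proof.
apply/hasP/idP => [[h]|af].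
  by rewrite mem_filter => /andP[/eqP eh _]; rewrite (info_movesE recall eh).
by exists (head [::] (info_nodes I)); first exact: info_head.
Qed.

Lemma plan_reachable i (p : plan G i) K :
  p \in plans_at (info_seq K) -> exists2 a, a \in acts K & val p K = Some a.
Proof.
rewrite plans_at_info_seq -reachableE => rK.
have /forallP/(_ K) := valP p; case: (val p K) => [a /andP[_ aK]|].
  by exists a.
by rewrite rK.
Qed.

(** * Pure strategies and reduced plans *)

Lemma acts_inhabited i (K : info G i) : exists a, a \in acts K.
Proof.
have [h hK] := info_inhabited K.
have [|a ha] := @info_at_decision _ _ G i h; first by rewrite hK.
by exists a; rewrite inE; apply/hasP; exists h; first exact: info_node.
Qed.

Definition some_action i (K : info G i) : act G := xchoose (acts_inhabited K).

Lemma some_actionP i (K : info G i) : some_action K \in acts K.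
Proof. exact: xchooseP. Qed.

Definition follows i (s : info G i -> act G) m := all (fun x => s x.1 == x.2) m.

Definition reduced i (s : info G i -> act G) : {ffun info G i -> option (act G)} :=
  [ffun K => if follows s (info_moves K) then Some (s K) else None].

(** By coherence the moves before the last entry are those leading to its information set, so once
    they are followed [reduced s] is defined there and equals [s]. *)
Lemma agrees_reduced i (s : info G i -> act G) m :
  coherent m -> agrees (reduced s) m = follows s m.
Proof.
elim/last_ind: m => [//|m [K a] IH] /coherent_rcons[eK /IH {}IH].
rewrite /agrees /follows !all_rcons -/(agrees _ _) -/(follows _ _) IH andbC.
rewrite [RHS]andbC; apply: andb_id2l => fm.
by rewrite ffunE /= eK fm.
Qed.

Lemma reduced_is_plan i (s : info G i -> act G) :
  (forall K, s K \in acts K) -> is_plan (reduced s).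
Proof.
move=> sP; apply/forallP => K.
rewrite reachableE agrees_reduced; last exact: coherent_info_moves.
by rewrite ffunE; case: ifP => //= _; rewrite sP.
Qed.

Definition plan_of i (s : info G i -> act G) (sP : forall K, s K \in acts K) :
  plan G i := exist _ (reduced s) (reduced_is_plan sP).

Lemma plan_of_seq_at i s (sP : forall K : info G i, s K \in acts K) z :
  (plan_of sP \in plans_at (seq_at i z)) = follows s (moves i z).
Proof. by rewrite plans_at_seq_at agrees_reduced //; apply: coherent_moves. Qed.

(** Where [p] is undefined an arbitrary action is filled in; agreement with coherent lists does not
    see this choice. *)
Definition completion i (p : plan G i) (K : info G i) : act G :=
  odflt (some_action K) (val p K).

Lemma completionP i (p : plan G i) K : completion p K \in acts K.
Proof.
rewrite /completion; have /forallP/(_ K) := valP p.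
by case: (val p K) => [a /andP[]|_] //=; apply: some_actionP.
Qed.

Lemma agrees_completion i (p : plan G i) m :
  coherent m -> agrees (val p) m = follows (completion p) m.
Proof.
elim/last_ind: m => [//|m [K a] IH] /coherent_rcons[eK /IH {}IH].
rewrite /agrees /follows !all_rcons -/(agrees _ _) -/(follows _ _) -IH andbC.
rewrite [RHS]andbC; apply: andb_id2l => fm /=.
have [|b _ pK] := @plan_reachable _ p K; first by rewrite plans_at_info_seq eK.
by rewrite /completion pK.
Qed.

(** * The information sets at or below a trigger *)

Definition below i (I K : info G i) : bool :=
  (K == I) || (I \in unzip1 (info_moves K)).

Lemma below_size i (I K : info G i) :
  below I K -> (size (info_moves I) <= size (info_moves K))%N.
Proof.
case/orP=> [/eqP->//|/unzip1_split[m1 [b [m2 e]]]].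
by rewrite e (coherent_info_moves e) size_cat leq_addr.
Qed.

Lemma below_child i (I J K : info G i) a :
  info_seq J = Some (K, a) -> below I J = (J == I) || below I K.
Proof.
move=> eJ; rewrite /below -(seq_moves_info_seq J) eJ /= /unzip1 map_rcons mem_rcons.
by rewrite inE [K == I]eq_sym.
Qed.

Lemma not_below_parent i (I K : info G i) a :
  info_seq I = Some (K, a) -> below I K = false.
Proof.
move=> eI; apply/negP => /below_size.
by rewrite -(seq_moves_info_seq I) eI /= size_rcons ltnn.
Qed.

Lemma below_root i (I J : info G i) :
  info_seq J = None -> below I J = (J == I).
Proof.
by move=> eJ; rewrite /below -(seq_moves_info_seq J) eJ orbF.
Qed.

Lemma leaf_info i z : z \in leaves G -> info_at G i z = None.
Proof.
rewrite !inE => /andP[_ lz]; case e: (info_at G i z) => [K|//].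
have [|a ha] := @info_at_decision _ _ G i z; first by rewrite e.
by case/negP: lz; apply/existsP; exists a.
Qed.

(** A leaf lies in no information set, so a node of [I] on its path is left by an action and thus
    recorded in the moves. *)
Lemma thruE i (I : info G i) z : z \in leaves G ->
  thru I z = (I \in unzip1 (moves i z)).
Proof.
move=> zL; apply/hasP/idP => [[u uI /prefixP[[|b s] ez]]|].
- move: uI; rewrite mem_filter => /andP[/eqP].
  by rewrite cats0 in ez; rewrite -ez leaf_info.
- move: uI; rewrite mem_filter => /andP[/eqP eu _].
  rewrite ez /moves moves_from_cat /unzip1 map_cat mem_cat /= eu /=.
  by rewrite mem_head orbT.
case/unzip1_split=> m1 [b [m2 /moves_split[_ [g [pg eg _]]]]].
exists g; first exact: info_node.
exact: prefix_trans (prefix_rcons _ _) pg.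
Qed.

Lemma thru_below i (I : info G i) z : z \in leaves G ->
  thru I z = if seq_at i z is Some (K, _) then below I K else false.
Proof.
move=> zL; rewrite thruE // -seq_moves_seq_at.
case: (seq_at i z) => [[K a]|//].
by rewrite /= /unzip1 map_rcons mem_rcons inE /below [I == K]eq_sym.
Qed.

(** * Grafting a deviation onto a plan *)

Definition graft_action i (I : info G i) (q p : plan G i) (K : info G i) : act G :=
  if below I K then completion q K else completion p K.

Lemma graft_actionP i (I : info G i) q p K : graft_action I q p K \in acts K.
Proof. by rewrite /graft_action; case: ifP => _; apply: completionP. Qed.

(* The plan that results from [p] when the trigger agent of [I] switches to [q]. *)
Definition graft i (I : info G i) (q p : plan G i) : plan G i :=
  if p \in plans_at (info_seq I) then plan_of (graft_actionP I q p) else p.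

(** On a path through [I] the sets before [I] remember fewer moves than [I], so they are not below
    it and [p] decides there; from [I] on, every set is below [I] and [q] decides. A path avoiding
    [I] meets no set below [I]. *)
Lemma graft_seq_at i (I : info G i) (q p : plan G i) z :
  q \in plans_at (info_seq I) -> z \in leaves G ->
  (graft I q p \in plans_at (seq_at i z)) =
  if thru I z then (p \in plans_at (info_seq I)) && (q \in plans_at (seq_at i z))
  else p \in plans_at (seq_at i z).
Proof.
move=> qI zL; have cz := @coherent_moves i z; have cI := coherent_info_moves (I := I).
move: qI; rewrite plans_at_info_seq agrees_completion // => qI.
case tz: (thru I z); move: tz; rewrite thruE //.
  case/unzip1_split=> m1 [b [m2 em]]; have eI := cz _ _ _ _ em.
  rewrite /graft; case: ifP; rewrite plans_at_info_seq agrees_completion // => pI.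
    rewrite plan_of_seq_at plans_at_seq_at agrees_completion // em /follows.
    rewrite !all_cat -/(follows _ m1) -/(follows (completion q) m1) -eI qI /=.
    have -> : follows (graft_action I q p) (info_moves I) =
              follows (completion p) (info_moves I).
      apply: eq_in_all => -[K a] /= /mem_split[m3 [m4 e]]; rewrite /graft_action.
      case: ifP => // /below_size; rewrite leqNgt e (cI _ _ _ _ e).
      by rewrite size_cat /= -ltn_subLR // subnn.
    rewrite pI /=; congr (_ && _).
      by rewrite /graft_action /below eqxx.
    apply: eq_in_all => -[K a] /= /mem_split[m3 [m4 e]]; rewrite /graft_action.
    rewrite (_ : below I K) //; apply/orP; right.
    rewrite (cz (m1 ++ (I, b) :: m3) K a m4); last by rewrite em e -catA.
    by rewrite /unzip1 map_cat mem_cat /= mem_head orbT.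
  rewrite plans_at_seq_at agrees_completion // em /follows all_cat.
  by rewrite -/(follows _ m1) -eI pI.
move=> tz; rewrite /graft; case: ifP => // pI.
rewrite plan_of_seq_at plans_at_seq_at agrees_completion //.
apply: eq_in_all => -[K a] /= /mem_split[m1 [m2 e]]; rewrite /graft_action.
case: ifP => // bK; move: tz; rewrite e /unzip1 map_cat mem_cat /= inE.
rewrite -(cz _ _ _ _ e) -/(unzip1 _) eq_sym; case/orP: bK => ->.
  by rewrite orbT.
by [].
Qed.
End Plans.

(** * Weak duality: feasible points are EFCCEs *)

Section Duality.
Context {R : realType} {n : nat} (G : game R n) (recall : perfect_recall G).
Implicit Types (i j : 'I_n) (h z : seq (act G)) (mu : {ffun plan_profile G -> R}).

(** This is the form given by [A_mx] at the plan induced by [mu] and the realisation vector of [q];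
    [follow_value] is its counterpart for [b_vec]. *)
Definition dev_value mu i (I : info G i) (q : plan G i) : R :=
  \sum_(z <- leaves G | thru I z)
    payoff G i z * (mass mu (dev (info_seq I) z) * (q \in plans_at (seq_at i z))%:R).

Definition follow_value mu i (I : info G i) : R :=
  \sum_(z <- leaves G | thru I z) payoff G i z * mass mu (seqs_at z).

(** Leaves that avoid [I] contribute equally to both utilities and cancel; the rest is linear in
    [nu]. *)
Lemma trigger_gain mu i (I : info G i) (nu : {ffun plan G i -> R}) :
  trigger_utility mu I nu - utility mu i =
  expect nu (dev_value mu I) - follow_value mu I.
Proof.
rewrite /trigger_utility /utility [X in _ - X](bigID (thru I)) /= -/(follow_value mu I).
rewrite opprD addrACA subrr addr0; congr (_ - _).
rewrite /expect; under [RHS]eq_bigr => q _ do rewrite big_distrr /=.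
rewrite exchange_big; apply: eq_bigr => z _ /=.
rewrite big_mkcond !big_distrr /=; apply: eq_bigr => q _.
by case: ifP; rewrite ?mulr1 ?mulr0 // [RHS]mulrCA [_ * nu q]mulrC.
Qed.

(** By linearity in [nu], deviations to single plans are the only ones to check. *)
Lemma efcceP mu : efcce mu <->
  distribution mu /\ forall i (I : info G i) q, q \in plans_at (info_seq I) ->
    dev_value mu I q <= follow_value mu I.
Proof.
split=> -[dmu H]; split=> // i I.
  move=> q qI; rewrite -subr_le0 -[dev_value _ _ _]expect_point -trigger_gain.
  rewrite subr_le0; apply: H; first exact: distribution_point.
  by move=> p pI; rewrite ffunE; case: eqP => // e; rewrite e qI in pI.
move=> nu dnu nuI; rewrite -subr_le0 trigger_gain subr_le0.
rewrite -(expect_cst (follow_value mu I) dnu); apply: expect_le => // q nq.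
by apply: H; apply: contraNT nq => /nuI ->.
Qed.

Lemma entry_induced mu s : is_relevant_profile s -> entry (induced mu) s = mass mu s.
Proof. by move=> rs; rewrite /entry insubT ffunE. Qed.

Lemma b_vec_induced mu i (I : info G i) :
  \sum_s b_vec I s * induced mu s = follow_value mu I.
Proof.
rewrite b_vecE big_seq_cond [RHS]big_seq_cond; apply: eq_bigr => z /andP[zL _].
by rewrite dev_self entry_induced // seqs_at_relevant.
Qed.

Lemma A_mx_induced mu i (I : info G i) (q : plan G i) :
  \sum_(t in Sigma G i) (\sum_s A_mx I s t * induced mu s) * (q \in plans_at t)%:R =
  dev_value mu I q.
Proof.
transitivity (\sum_s \sum_(t in Sigma G i)
    induced mu s * A_mx I s t * (q \in plans_at t)%:R).
  rewrite exchange_big; apply: eq_bigr => t _ /=; rewrite big_distrl.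
  by apply: eq_bigr => s _; rewrite /= [induced _ _ * _]mulrC.
rewrite A_mxE big_seq_cond [RHS]big_seq_cond; apply: eq_bigr => z /andP[zL tz].
by rewrite entry_induced ?mulrA //; apply: dev_relevant.
Qed.

Lemma A_mx_eq0 mu i (I : info G i) (t : sequence G i) :
  (if t is Some (K, _) then ~~ below I K else true) ->
  \sum_s A_mx I s t * induced mu s = 0.
Proof.
move=> nt; rewrite big1 // => s _; rewrite /A_mx big_seq_cond big1 ?mul0r //.
move=> z /andP[zL]; rewrite (thru_below recall) //.
have [e|_] := eqVneq t (seq_at i z); last by rewrite mulr0.
move: nt; rewrite e.
by case: (seq_at i z) => [[K a]|] // /negbTE ->.
Qed.

Lemma sum_plans_at_Some i (q : plan G i) K :
  \sum_(a in acts K) (q \in plans_at (Some (K, a) : sequence G i))%:R =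
  (q \in plans_at (info_seq K))%:R :> R.
Proof.
under eq_bigr do rewrite plans_at_Some // finset.in_setI finset.in_set.
case qK: (q \in plans_at (info_seq K)); last by rewrite big1.
have [a aK qa] := plan_reachable recall qK.
rewrite (bigD1 a) //= qa eqxx big1 ?addr0 // => b /andP[_ /negbTE nb].
by rewrite -[_ == _]/(a == b) eq_sym nb.
Qed.

(** The 0/1 realisation vector of a plan satisfies the flow equations, since a plan that reaches [K]
    takes exactly one action there. *)
Lemma plan_flow i (q : plan G i) r :
  \sum_(t in Sigma G i) F_mx r t * (q \in plans_at t)%:R = f_vec r.
Proof.
have sumt (t0 : sequence G i) : t0 \in Sigma G i ->
    \sum_(t in Sigma G i) (t == t0)%:R * (q \in plans_at t)%:R =
    (q \in plans_at t0)%:R :> R.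
  move=> t0S; rewrite (bigD1 t0) //= eqxx mul1r big1 ?addr0 // => t /andP[_ /negbTE ->].
  by rewrite mul0r.
case: r => [K|] /=; last by rewrite sumt ?plans_at_None ?inE.
under eq_bigr do rewrite mulrBl.
rewrite sumrB sumt; last exact: info_seq_Sigma.
under eq_bigr => t _ do rewrite big_distrl /=.
rewrite exchange_big /=.
apply/eqP; rewrite subr_eq0 -(sum_plans_at_Some q K); apply/eqP.
by apply: eq_bigr => a aK; rewrite sumt // inE.
Qed.

Lemma flow_dual i (q : plan G i) (v : option (info G i) -> R) :
  \sum_(t in Sigma G i) (\sum_r F_mx r t * v r) * (q \in plans_at t)%:R =
  \sum_r v r * f_vec r.
Proof.
under eq_bigr => t _ do rewrite big_distrl /=.
rewrite exchange_big; apply: eq_bigr => r _ /=.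
rewrite -(plan_flow q) big_distrr; apply: eq_bigr => t _ /=.
by rewrite -mulrA mulrCA.
Qed.

Lemma sum_slack mu i (I : info G i) (q : plan G i) w v :
  \sum_(t in Sigma G i) ((\sum_r F_mx r t * v r) + w * (t == info_seq I)%:R
      - \sum_s A_mx I s t * induced mu s) * (q \in plans_at t)%:R =
  \sum_r v r * f_vec r + w * (q \in plans_at (info_seq I))%:R - dev_value mu I q.
Proof.
under eq_bigr do rewrite mulrBl mulrDl.
rewrite sumrB big_split /= flow_dual A_mx_induced.
rewrite (bigD1 (info_seq I)) ?info_seq_Sigma //= eqxx mulr1.
rewrite [X in _ + (_ + X)]big1 ?addr0 // => t /andP[_ /negbTE->].
by rewrite mulr0 mul0r.
Qed.

(** Pairing the nonnegative slacks with the realisation vector of [q] bounds its deviation value by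
    [w] plus the [f_vec] term, which is at most [u] plus the follow value; then [u <= 0] is used. *)
Lemma lp_feasible_efcce (xi : cplan G) u w v :
  lp_feasible xi u w v -> efcce_cplan xi.
Proof.
move=> [Hb HA u0 [mu [dmu exi]]]; subst xi; exists mu; split=> //.
apply/efcceP; split=> // i I q qI.
have := Hb i I; rewrite b_vec_induced => Hi.
have : 0 <= \sum_(t in Sigma G i) ((\sum_r F_mx r t * v i I r)
      + w i I * (t == info_seq I)%:R - \sum_s A_mx I s t * induced mu s) *
      (q \in plans_at t)%:R.
  by apply: sumr_ge0 => t tS; rewrite mulr_ge0 ?ler0n ?HA.
by rewrite sum_slack qI mulr1; lra.
Qed.

End Duality.

(** * Explicit dual solutions: EFCCEs are feasible *)

Section Dual.
Context {R : realType} {n : nat} (G : game R n) (recall : perfect_recall G).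
Implicit Types (i j : 'I_n) (h z : seq (act G)) (mu : {ffun plan_profile G -> R}).

Lemma backward_induction i (g : sequence G i -> R) :
  exists (V : info G i -> R) (s : info G i -> act G),
  [/\ forall K, s K \in acts K,
      forall K a, a \in acts K ->
        g (Some (K, a)) + \sum_(J | info_seq J == Some (K, a)) V J <= V K &
      forall K, V K =
        g (Some (K, s K)) + \sum_(J | info_seq J == Some (K, s K)) V J].
Proof.
pose cont (W : info G i -> R) K a :=
  g (Some (K, a)) + \sum_(J | info_seq J == Some (K, a)) W J.
pose best W K := [arg max_(a > some_action K in acts K) cont W K a]%O.
have bestP W K : best W K \in acts K /\
    forall a, a \in acts K -> cont W K a <= cont W K (best W K).
  rewrite /best; case: Order.TotalTheory.arg_maxP => [|a aK amax].
    exact: some_actionP.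
  by split=> // b bK; exact: amax.
pose val m := iter m (fun W K => cont W K (best W K)) (fun=> 0).
pose N := (\max_(K : info G i) size (info_moves K))%N.
have leN (K : info G i) : (size (info_moves K) <= N)%N by apply: leq_bigmax.
(* The number of rounds depends on the depth so that the children of [K] use exactly one round less
   than [K]; this turns the iteration into a fixed-point equation for [V]. *)
pose V K := val (N.+1 - size (info_moves K))%N K.
have contV K a : cont (val (N - size (info_moves K))%N) K a = cont V K a.
  rewrite /cont; congr (_ + _); apply: eq_bigr => J /eqP eJ; rewrite /V.
  by rewrite -(seq_moves_info_seq recall J) eJ /= size_rcons subSS.
have VE K : V K = cont V K (best (val (N - size (info_moves K))%N) K).
  by rewrite -contV {1}/V subSn // /val iterS.
exists V, (fun K => best (val (N - size (info_moves K))%N) K); split=> // [K|K a aK].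
  by case: (bestP (val (N - size (info_moves K))%N) K).
rewrite VE -/(cont V K a) -!contV.
by case: (bestP (val (N - size (info_moves K))%N) K) => _; apply.
Qed.

Lemma info_moves_inj i (I K : info G i) a b :
  (K, a) \in info_moves I -> (K, b) \in info_moves I -> a = b.
Proof.
move=> /mem_split[m1 [m2 e1]] /mem_split[m3 [m4 e2]].
have cI := coherent_info_moves recall (I := I).
have := e1; rewrite e2 -(cI _ _ _ _ e1) -(cI _ _ _ _ e2).
by move/eqP; rewrite eqseq_cat // eqxx /= eqseq_cons => /andP[/eqP[->]].
Qed.

Lemma plan_reaching i (I : info G i) (s : info G i -> act G) :
  (forall K, s K \in acts K) ->
  exists2 q : plan G i, q \in plans_at (info_seq I) &
    forall K, below I K -> q \in plans_at (info_seq K) -> val q K = Some (s K).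
Proof.
move=> sP; have cI := coherent_info_moves recall (I := I).
(* On the way to [I] the remembered moves are played, elsewhere [s]. The two never conflict below
   [I], where at least as many moves are remembered as at [I]. *)
pose s' K := if [pick a | (K, a) \in info_moves I] is Some a then a else s K.
have s'P K : s' K \in acts K.
  rewrite /s'; case: pickP => [a /mem_split[m1 [m2 e]]|//].
  have [_ [g [pg eg _]]] := moves_split recall e.
  rewrite inE; apply/hasP; exists g; first exact: info_node.
  apply: prefix_node pg _.
  by have := info_head I; rewrite mem_filter => /andP[].
exists (plan_of recall s'P).
  rewrite plans_at_info_seq // agrees_reduced //.
  apply/allP => -[K a] Ka /=; rewrite /s'; case: pickP => [b Kb|/(_ a)].
    by rewrite (info_moves_inj Kb Ka).
  by rewrite Ka.
move=> K bK; rewrite plans_at_info_seq // agrees_reduced; last exact: coherent_info_moves.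
move=> fK; rewrite /= ffunE fK /s'; case: pickP => // a /mem_split[m1 [m2 e]].
have := below_size recall bK; rewrite e (cI _ _ _ _ e) size_cat /=.
by rewrite -[X in (_ <= X)%N]addn0 leq_add2l.
Qed.

Lemma F_mx_Some i (v : option (info G i) -> R) K a : a \in acts K ->
  \sum_r F_mx r (Some (K, a)) * v r =
  v (Some K) - \sum_(J | info_seq J == Some (K, a)) v (Some J).
Proof.
move=> aK; rewrite sum_option /= mul0r add0r.
under eq_bigr do rewrite mulrBl.
rewrite sumrB; congr (_ - _); last first.
  rewrite [RHS]big_mkcond; apply: eq_bigr => J _ /=; rewrite eq_sym.
  by case: eqP; rewrite ?mul1r ?mul0r.
rewrite (bigD1 K) //= (bigD1 a) //= eqxx big1 => [|b /andP[_ nb]].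
  rewrite addr0 mul1r big1 ?addr0 // => J nJ; rewrite big1 ?mul0r // => b _.
  by case: eqP => // -[e]; rewrite e eqxx in nJ.
by case: eqP => // -[e]; rewrite e eqxx in nb.
Qed.

Lemma F_mx_None i (v : option (info G i) -> R) :
  \sum_r F_mx r None * v r = v None - \sum_(J | info_seq J == None) v (Some J).
Proof.
rewrite sum_option /= mul1r; congr (_ + _); rewrite -sumrN [RHS]big_mkcond.
apply: eq_bigr => J _ /=; rewrite big1 // sub0r eq_sym mulNr.
by case: eqP; rewrite ?mul1r ?mul0r ?oppr0.
Qed.

(* The optimal continuation values below [I], found by backward induction, are
   a dual solution; a greedy plan satisfies complementary slackness with it. *)
Lemma dual_solution mu i (I : info G i) :
  exists (w : R) (v : option (info G i) -> R) (q : plan G i),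
  [/\ forall t, t \in Sigma G i ->
        0 <= (\sum_r F_mx r t * v r) + w * (t == info_seq I)%:R
             - \sum_s A_mx I s t * induced mu s,
      q \in plans_at (info_seq I) &
      w + \sum_r v r * f_vec r = dev_value mu I q].
Proof.
pose g (t : sequence G i) := \sum_s A_mx I s t * induced mu s.
have [V [s [sP Vge VE]]] := backward_induction g.
have [q qI qs] := plan_reaching I sP.
(* The values are cut off outside the part below [I], and [w] is taken to be [V I], the price of the
   flow entering [I]. *)
pose v (r : option (info G i)) :=
  if r is Some K then if below I K then V K else 0 else 0.
pose slack t := (\sum_r F_mx r t * v r) + V I * (t == info_seq I)%:R - g t.
(* At a sequence whose only possible child below [I] is [I] itself, the value passed up from the
   children is exactly what the [w] term compensates. *)
have root_child (t : sequence G i) :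
    (forall J, info_seq J = t -> below I J = (J == I)) ->
    \sum_(J | info_seq J == t) v (Some J) = V I * (t == info_seq I)%:R.
  move=> bJ; rewrite /v big_mkcond (bigD1 I) //= big1 => [|J nJ].
    rewrite addr0 eq_sym /below eqxx.
    by case: eqP; rewrite ?mulr1 ?mulr0.
  by case: eqP => // /bJ ->; rewrite (negbTE nJ).
have slackE K a : a \in acts K -> slack (Some (K, a)) = if below I K then
    V K - (g (Some (K, a)) + \sum_(J | info_seq J == Some (K, a)) V J) else 0.
  move=> aK; rewrite /slack F_mx_Some //; case bK: (below I K) => /=.
    rewrite bK; have -> : (Some (K, a) == info_seq I) = false.
      by apply/eqP => /esym /(not_below_parent recall); rewrite bK.
    rewrite mulr0 addr0 addrAC opprD addrA; congr (_ - _).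
    apply: eq_bigr => J /eqP /(below_child recall) ->.
    by rewrite bK orbT.
  rewrite bK root_child => [|J /(below_child recall) ->]; last by rewrite bK orbF.
  rewrite sub0r addNr sub0r /g A_mx_eq0 ?oppr0 //.
  by rewrite bK.
have slack_None : slack None = 0.
  rewrite /slack F_mx_None root_child => [|J]; last exact: below_root.
  by rewrite sub0r addNr sub0r /g A_mx_eq0 ?oppr0.
exists (V I), v, q; split=> //.
  move=> [[K a]|] tS; rewrite -/(g _) -/(slack _) ?slack_None //.
  rewrite inE in tS; rewrite slackE //; case: ifP => // _.
  by rewrite subr_ge0 Vge.
(* Complementary slackness: below [I] the plan [q] takes only maximising actions, where the slack is
   0, and all other slacks vanish. *)
have : \sum_(t in Sigma G i) slack t * (q \in plans_at t)%:R = 0.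
  apply: big1 => -[[K a]|] tS; last by rewrite slack_None mul0r.
  rewrite inE in tS; rewrite slackE //; case: ifP => [bK|_]; last by rewrite mul0r.
  case qt: (q \in _); last by rewrite mulr0.
  move: qt; rewrite plans_at_Some // finset.in_setI finset.in_set => /andP[qK /eqP qa].
  have := qs K bK qK; rewrite qa => -[->]; rewrite -VE subrr mul0r //.
by rewrite /slack sum_slack // qI mulr1; lra.
Qed.

(** With [u = 0], each trigger gets its own dual solution; the value of that solution is a deviation
    value, which the EFCCE condition bounds. *)
Lemma efcce_lp_feasible (xi : cplan G) :
  efcce_cplan xi -> exists u w v, lp_feasible xi u w v.
Proof.
case=> mu [/efcceP[dmu H] ->]; pose D i I := boolp.cid (dual_solution mu (i := i) I).
exists 0, (fun i I => sval (D i I)).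
exists (fun i I => [ffun r => sval (boolp.cid (svalP (D i I))) r]).
split=> // [i I|i I t tS|]; last by exists mu.
all: case: boolp.cid => v /= [q [Hv qI Hq]].
  rewrite b_vec_induced; under eq_bigr do rewrite ffunE.
  by have := H i I q qI; lra.
under eq_bigr do rewrite ffunE.
exact: Hv.
Qed.

End Dual.

(** * Existence of an EFCCE and of an optimal one *)

Section Existence.
Context {R : realType} {n : nat} (G : game R n) (recall : perfect_recall G).
Implicit Types (i j : 'I_n) (h z : seq (act G)) (mu : {ffun plan_profile G -> R}).

Lemma massE mu s :
  mass mu s = expect mu (fun p => [forall j, p j \in plans_at (s j)]%:R).
Proof.
rewrite /mass big_mkcond; apply: eq_bigr => p _ /=.
by case: ifP; rewrite ?mulr1 ?mulr0.
Qed.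

(** Linearity in [mu], stated through point masses, puts the incentive conditions in the form
    required by [simplex_feasible] and [polytope_min]. *)
Lemma mass_expect mu s : mass mu s = expect mu (fun p => mass (point p) s).
Proof. by rewrite massE; apply: eq_expect => p; rewrite massE expect_point. Qed.

Lemma follow_value_expect mu i (I : info G i) :
  follow_value mu I = expect mu (fun p => follow_value (point p) I).
Proof. by rewrite expect_sum; apply: eq_bigr => z _; rewrite -mass_expect. Qed.

Lemma dev_value_expect mu i (I : info G i) q :
  dev_value mu I q = expect mu (fun p => dev_value (point p) I q).
Proof.
rewrite expect_sum; apply: eq_bigr => z _; congr (_ * _).
rewrite mass_expect mulrC -[RHS]mul1r.
rewrite /expect !big_distrr; apply: eq_bigr => p _ /=.
by rewrite mul1r mulrC mulrA.
Qed.

Lemma dot_induced_expect (c : cplan G) mu :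
  dot c (induced mu) = expect mu (fun p => dot c (induced (point p))).
Proof.
rewrite /dot expect_sum; apply: eq_bigr => s _; congr (_ * _).
by rewrite ffunE mass_expect; apply: eq_expect => p; rewrite ffunE.
Qed.

Definition trigger : finType := {i : 'I_n & (info G i * plan G i)%type}.

(** Pairs whose plan does not lead to [K] stay in the index type with gain 0, a constraint that
    always holds. *)
Definition gain (k : trigger) mu : R :=
  let: existT i (K, q) := k in
  if q \in plans_at (info_seq K) then dev_value mu K q - follow_value mu K else 0.

Lemma gain_expect k mu : gain k mu = expect mu (fun p => gain k (point p)).
Proof.
case: k => i [I q] /=; case: ifP => _; last by rewrite expect0.
by rewrite expectB -dev_value_expect -follow_value_expect.
Qed.

Lemma efcce_gainP mu : efcce mu <->
  distribution mu /\ forall k, expect mu (fun p => gain k (point p)) <= 0.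
Proof.
rewrite efcceP; split=> -[dmu H]; split=> //.
  move=> [i [I q]]; rewrite -gain_expect /=; case: ifP => // qI.
  by rewrite subr_le0 H.
move=> i I q qI; have := H (existT _ i (I, q)).
by rewrite -gain_expect /= qI subr_le0.
Qed.

Definition product_dist (x : forall i, {ffun plan G i -> R}) :
    {ffun plan_profile G -> R} :=
  [ffun p : plan_profile G => \prod_i x i (p i)].

Lemma distribution_product x : (forall i, distribution (x i)) ->
  distribution (product_dist x).
Proof.
move=> dx; split=> [p|]; first by rewrite ffunE prodr_ge0 // => i _; case: (dx i).
under eq_bigr do rewrite ffunE.
by rewrite (sum_dffun_prod x) big1 // => i _; case: (dx i).
Qed.

(** Independence: the indicator of the joint event is the product of the indicators of the
    players. *)
Lemma mass_product x s : mass (product_dist x) s =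
  \prod_i expect (x i) (fun q => (q \in plans_at (s i))%:R).
Proof.
rewrite massE /expect.
pose F i := [ffun q => x i q * (q \in plans_at (s i))%:R].
transitivity (\sum_(p : plan_profile G) \prod_i F i (p i)).
  apply: eq_bigr => p _; rewrite ffunE; under [RHS]eq_bigr do rewrite ffunE.
  rewrite big_split /=; congr (_ * _).
  case: forallP => [ps|/forallP]; first by rewrite big1 // => i _; rewrite ps.
  by rewrite negb_forall => /existsP[i /negbTE ni]; rewrite (bigD1 i) //= ni mul0r.
rewrite sum_dffun_prod; apply: eq_bigr => i _; apply: eq_bigr => q _.
by rewrite ffunE.
Qed.

(* Under a product distribution, a trigger deviation acts on the deviator's
   marginal through [graft] and leaves the other factors of each leaf alone. *)
Lemma gain_product (x : forall i, {ffun plan G i -> R}) i (I : info G i) q :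
  let g (p : plan G i) := \sum_(z <- leaves G) payoff G i z *
    (\prod_(j | j != i) expect (x j) (fun p => (p \in plans_at (seq_at j z))%:R)) *
    (p \in plans_at (seq_at i z))%:R in
  q \in plans_at (info_seq I) ->
  gain (existT _ i (I, q)) (product_dist x) =
  expect (x i) (g \o graft recall I q) - expect (x i) g.
Proof.
move=> g qI /=; rewrite qI /g !expect_sum -sumrB /dev_value /follow_value -sumrB.
rewrite big_mkcond big_seq [RHS]big_seq; apply: eq_bigr => z zL.
set c := \prod_(j | _) _.
have prodE s : mass (product_dist x) (dev s z) =
    expect (x i) (fun p => (p \in plans_at s)%:R) * c.
  rewrite mass_product (bigD1 i) //= ffunE dfwith_in; congr (_ * _).
  by apply: eq_bigr => j nj; rewrite ffunE dfwith_out // eq_sym.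
(* Away from [I] the graft changes nothing. Through [I] its realisation weight factors into reaching
   [I] with the old plan and continuing with [q]. *)
rewrite -(dev_self i z) !prodE; case: ifP => tz; last first.
  rewrite -mulrBr -expectB (eq_expect _ (g := fun=> 0)) ?expect0 ?mulr0 // => p.
  by rewrite graft_seq_at // tz subrr.
have -> : expect (x i) (fun p => (graft recall I q p \in plans_at (seq_at i z))%:R) =
    expect (x i) (fun p => (p \in plans_at (info_seq I))%:R) *
    (q \in plans_at (seq_at i z))%:R.
  rewrite /expect big_distrl; apply: eq_bigr => p _ /=.
  by rewrite graft_seq_at // tz -mulrA -natrM mulnb.
by ring.
Qed.

(* Hart and Schmeidler: against any weighting of the triggers, let each player
   independently draw a plan from a distribution that is stationary under the
   weighted trigger deviations of that player. *)
Lemma efcce_exists : exists mu, efcce mu.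
Proof.
have [|mu H] := @simplex_feasible R _ trigger (fun k p => gain k (point p)).
  move=> lam lam0.
  (* Ineligible pairs act as the identity, in accordance with their gain 0. *)
  pose phi i (k : info G i * plan G i) p :=
    if k.2 \in plans_at (info_seq k.1) then graft recall k.1 k.2 p else p.
  pose D i := boolp.cid (stationary_distribution (phi i)
    (plan_of recall (@some_actionP _ _ G i)) (fun k => lam0 (existT _ i k))).
  pose x i := sval (D i).
  exists (product_dist x); split.
    by apply: distribution_product => i; case: (svalP (D i)).
  under eq_bigr do rewrite -gain_expect.
  rewrite (_ : \sum_k _ = \sum_i \sum_(k : info G i * plan G i)
    lam (existT _ i k) * gain (existT _ i k) (product_dist x)); last first.
    by rewrite sig_big_dep; apply: eq_bigr => -[].
  rewrite big1 // => i _; have [_ st] := svalP (D i).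
  (* The expected payoff of a plan of player [i] against the product of the others; stationarity for
     this test function makes the weighted gains of [i] cancel. *)
  pose g (p : plan G i) := \sum_(z <- leaves G) payoff G i z *
    (\prod_(j | j != i) expect (x j) (fun p => (p \in plans_at (seq_at j z))%:R)) *
    (p \in plans_at (seq_at i z))%:R.
  rewrite -[RHS](st g); apply: eq_bigr => -[I q] _; congr (_ * _).
  have [qI|qI] := boolP (q \in plans_at (info_seq I)).
    rewrite gain_product //; congr (_ - _); apply: eq_expect => p.
    by rewrite /= /phi /= qI.
  rewrite /= (negbTE qI); apply/esym/eqP; rewrite subr_eq0; apply/eqP/eq_expect => p.
  by rewrite /= /phi /= (negbTE qI).
by exists mu; apply/efcce_gainP.
Qed.

(** In terms of [mu], a linear objective is optimised over a nonempty polytope; its negative is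
    minimised. *)
Lemma max_efcce_exists (c : cplan G) : exists xi, max_efcce c xi.
Proof.
pose f (p : plan_profile G) := - dot c (induced (point p)).
have fE mu : expect mu f = - dot c (induced mu).
  rewrite dot_induced_expect /expect -sumrN.
  by apply: eq_bigr => p _; rewrite mulrN.
have [|mu [dmu lmu mumin]] :=
  @polytope_min R _ trigger (fun k p => gain k (point p)) (fun mu => expect mu f)
    (continuous_expect (f := f)).
  by have [mu /efcce_gainP] := efcce_exists; exists mu.
exists (induced mu); split; first by exists mu; split=> //; apply/efcce_gainP.
move=> _ [mu' [/efcce_gainP[dmu' lmu'] ->]].
by have := mumin mu' dmu' lmu'; rewrite !fE lerN2.
Qed.

Lemma welfare_induced mu : dot (welfare_obj G) (induced mu) = welfare mu.
Proof.
rewrite welfare_objE /welfare /utility exchange_big /=.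
rewrite big_seq [RHS]big_seq; apply: eq_bigr => z zL.
by rewrite entry_induced ?seqs_at_relevant // big_distrl.
Qed.

End Existence.

(** * Correctness of the linear program *)

Theorem mainTheorem8 (R : realType) (n : nat) (G : game R n)
    (recall : perfect_recall G) :
  (forall c : cplan G,
     (exists xi u w v, lp_optimal c xi u w v) /\
     (forall xi, (exists u w v, lp_optimal c xi u w v) <-> max_efcce c xi)) /\
  (forall xi : cplan G,
     dot (welfare_obj G) xi =
     \sum_(z <- leaves G) (\sum_(i < n) payoff G i z) * entry xi (seqs_at z)) /\
  (forall xi u w v,
     lp_optimal (welfare_obj G) xi u w v -> welfare_max_efcce xi).
Proof.
(* The feasible set projects onto exactly the EFCCE plans, and the objective depends on [xi] alone,
   so the optima coincide. *)
have optP c (xi : cplan G) :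
    (exists u w v, lp_optimal c xi u w v) <-> max_efcce c xi.
  split=> [[u [w [v [fxi xmax]]]]|[/(efcce_lp_feasible recall)[u [w [v fxi]]] xmax]].
    split=> [|xi' /(efcce_lp_feasible recall)[u' [w' [v' fxi']]]].
      exact: lp_feasible_efcce fxi.
    exact: xmax fxi'.
  exists u, w, v; split=> // xi' u' w' v' fxi'.
  by apply: xmax; apply: lp_feasible_efcce fxi'.
split=> [c|]; last split=> [xi|xi u w v opt].
- split=> [|xi]; last exact: optP.
  by have [xi /optP xmax] := max_efcce_exists recall c; exists xi.
- exact: welfare_objE.
have [|[mu [emu ->]] xmax] := (optP (welfare_obj G) xi).1; first by exists u, w, v.
exists mu; split=> // mu' emu'; rewrite -!welfare_induced.
by have := xmax (induced mu'); apply; exists mu'.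
Qed.
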